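(* Assume the CFL condition $\tau<C_{\rm CFL}h$ with $C_{\rm CFL}<2/\sqrt{C_s}$. Let $$M=M(\tau)=\begin{bmatrix}I-\frac{\tau^2}{2}\Lambda_h&\tau I-\frac{\tau^3}{4}\Lambda_h\\-\tau\Lambda_h&I-\frac{\tau^2}{2}\Lambda_h\end{bmatrix}$$ act on $V_h\times V_h$. Then for every $\alpha\in\mathbb R$ and every $v=[v_1,v_2]^T\in\mathcal H_h^\alpha$, $$\|Mv\|_{m,\alpha}=\|v\|_{m,\alpha}.$$
   Context: $\mathcal D\subset\mathbb R^d$, $d\in\{1,2,3\}$, is a bounded convex polytopal domain; $(\cdot,\cdot)$, $\|\cdot\|$ are the $L_2(\mathcal D)$ inner product and norm. $\mathbf D(x)$ is a symmetric $d\times d$ matrix function with $0<d_{\min}\le \zeta^T\mathbf D(x)\zeta\le d_{\max}<\infty$ for all $|\zeta|=1$. $\mathcal T_h$ is a family of regular, quasi-uniform meshes of $\mathcal D$ (triangles/parallelograms for $d=2$, tetrahedra/parallelepipeds for $d=3$, intervals for $d=1$), $h$ the maximal element diameter. $V_h=\{u\in L_2(\mathcal D):u|_{K}\in\mathcal P^p(K)\ \forall K\in\mathcal T_h\}$, $\mathcal P^p$ the polynomials of total degree $\le p$, $p\ge1$. $\mathfrak F_h$ is the set of all faces, $h_{\mathfrak F}$ the diameter of face $\mathfrak F$. On an interior face shared by $K^\pm$ with outward normals $\mathbf n^\pm$: $\{u\}=\frac12(u^++u^-)$, $[u]=u^+\mathbf n^++u^-\mathbf n^-$; on a boundary face $\{u\}=u$,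 $[u]=u\mathbf n$. The symmetric interior penalty form is $$B_h(u,v)=\sum_K\int_K\mathbf D\nabla u\cdot\nabla v\,dx-\sum_{\mathfrak F}\int_{\mathfrak F}\{\mathbf D\nabla u\}\cdot[v]\,ds-\sum_{\mathfrak F}\int_{\mathfrak F}[u]\cdot\{\mathbf D\nabla v\}\,ds+\sigma_0\sum_{\mathfrak F}\int_{\mathfrak F}h_{\mathfrak F}^{-1}\mathbf D[u]\cdot[v]\,ds,$$ with $\sigma_0>0$ fixed, independent of $h$, large enough that $B_h(u,u)\ge\frac12\|u\|_*^2$ on $V_h$, where $\|u\|_*^2=\sum_K\|\nabla u\|_{L_2(K)}^2+\sum_Kh_K^2\|\Delta u\|_{L_2(K)}^2+\sum_{\mathfrak F}h_{\mathfrak F}^{-1}\|[u]\|_{L_2(\mathfrak F)}^2$. $C_s>0$ is an $h$-independent constant with $B_h(u,u)\le C_sh^{-2}\|u\|^2$ for all $u\in V_h$. $\Lambda_h:V_h\to V_h$ is the symmetric positive definite operator with $(\Lambda_hv,w)=B_h(v,w)$ for all $v,w\in V_h$; all its eigenvalues are at most $C_sh^{-2}$. $\mathcal H_h^\alpha=V_h\times V_h$. $\tau>0$ is the time step. Under the CFL condition $I-\frac{\tau^2}4\Lambda_h$ is positive definite. The discrete norm is $\|v\|_{m,\alpha}^2=\langle v,v\rangle_{m,\alpha}$, where for $v,w\in V_h\times V_h$ $$\langle v,w\rangle_{m,\alpha}=(V^{-1}w)^*\begin{bmatrix}\Lambda_h^{\alpha-1}&0\\0&\Lambda_h^{\alpha-1}\end{bmatrix}V^{-1}v,\qquad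 V^{-1}=\frac12\begin{bmatrix}i\Lambda_h^{1/2}(I-\frac{\tau^2}{4}\Lambda_h)^{-1/2}&I\\-i\Lambda_h^{1/2}(I-\frac{\tau^2}{4}\Lambda_h)^{-1/2}&I\end{bmatrix},$$ $(\cdot)^*$ denoting the conjugate transpose with respect to the $L_2(\mathcal D)$ inner product on the complexification of $V_h$. *)

(* Defs.v *)
From HB Require Import structures.
From mathcomp Require Import all_boot all_order all_algebra.
From mathcomp Require Import all_classical all_reals all_analysis.
From mathcomp Require Import complex.

Set Implicit Arguments.
Unset Strict Implicit.
Unset Printing Implicit Defensive.

Import Order.TTheory GRing.Theory Num.Theory.
Import numFieldNormedType.Exports.

Local Open Scope classical_set_scope.
Local Open Scope ring_scope.

(* The space dimension d >= 1 is written n.+1, so that faces have dimension n.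
   Points and vectors of R^d are column vectors. *)

(* The library's norm on matrices is the sup norm; lengths and diameters here
   are Euclidean. *)

Definition dotp (R : realType) m (u v : 'cV[R]_m) : R := (u^T *m v) 0 0.

Definition enorm (R : realType) m (u : 'cV[R]_m) : R := Num.sqrt (dotp u u).

Definition normalize (R : realType) m (u : 'cV[R]_m) : 'cV[R]_m :=
  (enorm u)^-1 *: u.

Definition diam (R : realType) m (A : set 'cV[R]_m) : R :=
  sup [set r | exists x y, [/\ A x, A y & r = enorm (x - y)]].

(* The domain is open: the interior of the convex hull of finitely many points,
   the columns of P. *)
Definition convex_polytopal (R : realType) n (Dom : set 'cV[R]_n.+1) : Prop :=
  Dom !=set0 /\
  exists k (P : 'M[R]_(n.+1, k)),
    Dom = interior [set P *m w | w in
            [set w : 'cV[R]_k | (forall i, 0 <= w i 0) /\ \sum_i w i 0 = 1]].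

(* The library has Lebesgue measure on R and binary product measures.  R^m is
   modelled by the iterated product (unit * R) * ... * R, the last factor being
   the first coordinate; mm_pt reads a point of the product as a column vector.
   For m = 0 the measure is the unit mass at the only point. *)

Record measure_model (R : realType) (m : nat) := MeasureModel {
  mm_disp : measure_display;
  mm_car : measurableType mm_disp;
  mm_leb : {measure set mm_car -> \bar R};
  mm_pt : mm_car -> 'cV[R]_m }.

Fixpoint lebesgue_model (R : realType) (m : nat) : measure_model R m :=
  match m with
  | 0 => @MeasureModel R 0 _ unit (dirac tt) (fun=> 0)
  | m'.+1 =>
      let E := lebesgue_model R m' in
      @MeasureModel R m'.+1 _ (mm_car E * measurableTypeR R)%type
        (mm_leb E \x lebesgue_measure)%E
        (fun y => col_mx (y.2)%:M (mm_pt y.1) : 'cV[R]_(1 + m'))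
  end.

Definition model_pt (R : realType) m : mm_car (lebesgue_model R m) -> 'cV[R]_m :=
  @mm_pt R m (lebesgue_model R m).

Definition leb_int (R : realType) m (A : set 'cV[R]_m) (f : 'cV[R]_m -> R) : R :=
  \int[mm_leb (lebesgue_model R m)]_(y in @model_pt R m @^-1` A) f (model_pt y).

Definition leb_measurable (R : realType) m (A : set 'cV[R]_m)
    (f : 'cV[R]_m -> R) : Prop :=
  measurable_fun (@model_pt R m @^-1` A) (f \o @model_pt R m).

Definition partial_der (R : realType) n (j : 'I_n.+1) (f : 'cV[R]_n.+1 -> R)
    (x : 'cV[R]_n.+1) : R :=
  'D_(delta_mx j 0) f x.

Definition grad (R : realType) n (f : 'cV[R]_n.+1 -> R) (x : 'cV[R]_n.+1) :
    'cV[R]_n.+1 :=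
  \col_j partial_der j f x.

Definition laplacian (R : realType) n (f : 'cV[R]_n.+1 -> R)
    (x : 'cV[R]_n.+1) : R :=
  \sum_j partial_der j (partial_der j f) x.

(* D takes symmetric values bounded between dmin and dmax.  It is given up to
   the boundary because it is also integrated over the boundary faces. *)
Definition diffusion_tensor (R : realType) n (Dom : set 'cV[R]_n.+1)
    (dmin dmax : R) (D : 'cV[R]_n.+1 -> 'M[R]_n.+1) : Prop :=
  [/\ 0 < dmin,
      forall i j, leb_measurable (closure Dom) (fun x => D x i j),
      forall x, closure Dom x -> (D x)^T = D x &
      forall x, closure Dom x -> forall z : 'cV[R]_n.+1, enorm z = 1 ->
        dmin <= dotp z (D x *m z) <= dmax].

(* In dimension 1 both shapes are intervals, in dimension 2 they are triangles
   and parallelograms, in dimension 3 tetrahedra and parallelepipeds. *)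

Inductive shape := Simplex | Parallelotope.

Definition ref_cell (R : realType) m (s : shape) : set 'cV[R]_m :=
  match s with
  | Simplex => [set y | (forall i, 0 <= y i 0) /\ \sum_i y i 0 <= 1]
  | Parallelotope => [set y | forall i, 0 <= y i 0 <= 1]
  end.

(* The closed image of the m-dimensional reference cell under the affine map
   y |-> org + edg *m y from R^m to R^d. *)
Record patch (R : realType) (d m : nat) :=
  Patch { shp : shape; org : 'cV[R]_d; edg : 'M[R]_(d, m) }.

Definition chart (R : realType) d m (P : patch R d m) (y : 'cV[R]_m) : 'cV[R]_d :=
  org P + edg P *m y.

Definition carrier (R : realType) d m (P : patch R d m) : set 'cV[R]_d :=
  chart P @` ref_cell (shp P).

(* Integral against m-dimensional surface measure: the Gram determinant of the
   edges is the squared volume element.  For m = 0 this is the value at org. *)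
Definition surface_int (R : realType) d m (P : patch R d m) (f : 'cV[R]_d -> R) : R :=
  Num.sqrt (\det ((edg P)^T *m edg P)) *
  leb_int (ref_cell (shp P)) (f \o chart P).

(* Let y_0, ..., y_n be the reference coordinates of a cell.  The facet (i, false)
   is y_i = 0.  The facet (i, true) is y_i = 1 for a parallelotope, and for a
   simplex it is the facet opposite to org, sum_j y_j = 1, charted from its i-th
   vertex; to list that facet only once, only i = 0 is kept. *)

Definition valid_facet (R : realType) n (K : patch R n.+1 n.+1)
    (f : 'I_n.+1 * bool) : bool :=
  match shp K with
  | Simplex => f.2 ==> (f.1 == ord0)
  | Parallelotope => true
  end.

Definition facet (R : realType) n (K : patch R n.+1 n.+1) (f : 'I_n.+1 * bool) :
    patch R n.+1 n :=
  let e := col f.1 (edg K) in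
  match f.2, shp K with
  | false, s => Patch s (org K) (col' f.1 (edg K))
  | true, Parallelotope => Patch Parallelotope (org K + e) (col' f.1 (edg K))
  | true, Simplex => Patch Simplex (org K + e)
      (col' f.1 (\matrix_(i, j) (edg K i j - e i 0)))
  end.

(* The rows of the inverse edge matrix are the gradients of the y_i. *)
Definition outward_normal (R : realType) n (K : patch R n.+1 n.+1)
    (f : 'I_n.+1 * bool) : 'cV[R]_n.+1 :=
  let dy i := (row i (invmx (edg K)))^T in
  normalize
    (match f.2, shp K with
     | false, _ => - dy f.1
     | true, Parallelotope => dy f.1
     | true, Simplex => \sum_i dy i
     end).

Record mesh (R : realType) (n : nat) :=
  Mesh { ncells : nat; cell : 'I_ncells -> patch R n.+1 n.+1 }.

Definition facet_id (R : realType) n (T : mesh R n) : Type :=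
  ('I_(ncells T) * ('I_n.+1 * bool))%type.

Definition facet_of (R : realType) n (T : mesh R n) (f : facet_id T) :
    patch R n.+1 n :=
  facet (cell f.1) f.2.

Definition valid (R : realType) n (T : mesh R n) (f : facet_id T) : bool :=
  valid_facet (cell f.1) f.2.

Definition normal (R : realType) n (T : mesh R n) (f : facet_id T) : 'cV[R]_n.+1 :=
  outward_normal (cell f.1) f.2.

(* The last condition excludes hanging nodes. *)
Definition mesh_of (R : realType) n (Dom : set 'cV[R]_n.+1) (T : mesh R n) : Prop :=
  [/\ forall K, edg (cell (m := T) K) \in unitmx,
      closure Dom = \bigcup_(K in [set: 'I_(ncells T)]) carrier (cell K),
      forall K K' : 'I_(ncells T), K != K' ->
        interior (carrier (cell K)) `&` interior (carrier (cell K')) = set0 &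
      forall f : facet_id T, valid f ->
        carrier (facet_of f) `<=` closure Dom `\` Dom \/
        exists f' : facet_id T, [/\ valid f', f'.1 != f.1 &
          carrier (facet_of f') = carrier (facet_of f)]].

Definition hcell (R : realType) n (T : mesh R n) (K : 'I_(ncells T)) : R :=
  diam (carrier (cell K)).

Definition hmax (R : realType) n (T : mesh R n) : R :=
  \big[Num.max/0]_(K < ncells T) hcell K.

(* Every cell contains a ball of radius kappa times its diameter, and has
   diameter at least kappa times the mesh size, with one kappa for the family. *)
Definition regular_quasi_uniform (R : realType) n (I : Type) (T : I -> mesh R n) :
    Prop :=
  exists2 kappa : R, 0 < kappa &
    forall i (K : 'I_(ncells (T i))),
      (exists c, [set x | enorm (x - c) <= kappa * hcell K]
                   `<=` carrier (cell K)) /\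
      kappa * hmax (T i) <= hcell K.

(* A face of the mesh is (f, Some f') when the facets f of K^+ and f' of K^-
   coincide, and (f, None) when f lies on the boundary.  Ordering the two cells
   makes each interior face occur once; nothing below depends on which cell is
   called K^+. *)

Definition face (R : realType) n (T : mesh R n) : Type :=
  (facet_id T * option (facet_id T))%type.

Definition is_face (R : realType) n (Dom : set 'cV[R]_n.+1) (T : mesh R n)
    (F : facet_id T * option (facet_id T)) : Prop :=
  match F.2 with
  | Some f' => [/\ valid F.1, valid f', (F.1.1 < f'.1)%N &
                   carrier (facet_of F.1) = carrier (facet_of f')]
  | None => valid F.1 /\ carrier (facet_of F.1) `<=` closure Dom `\` Dom
  end.

(* In dimension 1 a face is a point and has diameter 0; its size is then taken
   to be the least diameter of the adjacent cells. *)
Definition hface (R : realType) n (T : mesh R n) (F : face T) : R :=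
  if n is 0 then
    match F.2 with
    | Some f' => Num.min (hcell F.1.1) (hcell f'.1)
    | None => hcell F.1.1
    end
  else diam (carrier (facet_of F.1)).

Definition face_int (R : realType) n (T : mesh R n) (F : face T)
    (g : 'cV[R]_n.+1 -> R) : R :=
  surface_int (facet_of F.1) g.

Definition average (R : realType) n (T : mesh R n) (F : face T)
    (w : 'I_(ncells T) -> 'cV[R]_n.+1) : 'cV[R]_n.+1 :=
  match F.2 with
  | Some f' => 2^-1 *: (w F.1.1 + w f'.1)
  | None => w F.1.1
  end.

Definition jump (R : realType) n (T : mesh R n) (F : face T)
    (w : 'I_(ncells T) -> R) : 'cV[R]_n.+1 :=
  match F.2 with
  | Some f' => w F.1.1 *: normal F.1 + w f'.1 *: normal f'
  | None => w F.1.1 *: normal F.1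
  end.

(* V_h is the space 'cV_(ndof T p) of families of monomial coefficients, one
   polynomial of total degree at most p for each cell. *)

Definition multi_index (n p : nat) : Type :=
  {a : {ffun 'I_n.+1 -> 'I_p.+1} | (\sum_i a i <= p)%N}.

HB.instance Definition _ n p := Finite.on (multi_index n p).

Definition ndof (R : realType) n (T : mesh R n) (p : nat) : nat :=
  #|{: 'I_(ncells T) * multi_index n p}|.

Definition on_cell (R : realType) n (T : mesh R n) p (u : 'cV[R]_(ndof T p))
    (K : 'I_(ncells T)) (x : 'cV[R]_n.+1) : R :=
  \sum_(a : multi_index n p)
     u (enum_rank (K, a)) 0 * \prod_j x j 0 ^+ (val a j).

Definition cell_int (R : realType) n (T : mesh R n) (K : 'I_(ncells T))
    (g : 'cV[R]_n.+1 -> R) : R :=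
  leb_int (carrier (cell K)) g.

Definition L2dot (R : realType) n (T : mesh R n) p (u v : 'cV[R]_(ndof T p)) : R :=
  \sum_K cell_int K (fun x => on_cell u K x * on_cell v K x).

Section InteriorPenalty.
Variables (R : realType) (n : nat) (Dom : set 'cV[R]_n.+1).
Variable D : 'cV[R]_n.+1 -> 'M[R]_n.+1.
Variables (T : mesh R n) (p : nat).
Implicit Types (u v : 'cV[R]_(ndof T p)) (F : face T) (x : 'cV[R]_n.+1).

Definition sum_faces (g : facet_id T * option (facet_id T) -> R) : R :=
  \sum_(F : facet_id T * option (facet_id T) | `[< is_face Dom F >]) g F.

Definition flux u x (K : 'I_(ncells T)) : 'cV[R]_n.+1 :=
  D x *m grad (on_cell u K) x.

Definition jump_at F u x : 'cV[R]_n.+1 := jump F (fun K => on_cell u K x).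

Definition Bh (sigma0 : R) u v : R :=
  \sum_K cell_int K (fun x => dotp (flux u x K) (grad (on_cell v K) x))
  - sum_faces (fun F => face_int F (fun x =>
      dotp (average F (flux u x)) (jump_at F v x)))
  - sum_faces (fun F => face_int F (fun x =>
      dotp (jump_at F u x) (average F (flux v x))))
  + sigma0 * sum_faces (fun F => face_int F (fun x =>
      (hface F)^-1 * dotp (D x *m jump_at F u x) (jump_at F v x))).

Definition star_norm_sq u : R :=
  \sum_K cell_int K (fun x => enorm (grad (on_cell u K) x) ^+ 2)
  + \sum_K (hcell K) ^+ 2 *
      cell_int K (fun x => laplacian (on_cell u K) x ^+ 2)
  + sum_faces (fun F => (hface F)^-1 *
      face_int F (fun x => enorm (jump_at F u x) ^+ 2)).

(* Operators on V_h are matrices acting on coefficient vectors, so symmetry and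
   definiteness refer to L2dot and not to the matrix entries. *)
Definition is_Lambda (sigma0 : R) (Lam : 'M[R]_(ndof T p)) : Prop :=
  [/\ forall u v, L2dot (Lam *m u) v = Bh sigma0 u v,
      forall u v, L2dot (Lam *m u) v = L2dot u (Lam *m v) &
      forall u, u != 0 -> 0 < L2dot (Lam *m u) u].

End InteriorPenalty.

(* The operator acting as the scalar l^s on the l-eigenspace of A; it exists and
   is unique when the eigenvectors of A span, as they do if A is self-adjoint for
   an inner product. *)
Definition op_pow (R : realType) m (A : 'M[R]_m) (s : R) : 'M[R]_m :=
  xget 0 [set B | forall (l : R) (v : 'cV[R]_m),
            A *m v = l *: v -> B *m v = (l `^ s) *: v].

(* Complexification: complex coefficient vectors, with the sesquilinear extension
   of L2dot that is conjugate-linear in its second argument. *)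

Definition toC (R : realType) m k (A : 'M[R]_(m, k)) : 'M[R[i]]_(m, k) :=
  map_mx (real_complex R) A.

Definition L2dotC (R : realType) n (T : mesh R n) p (x y : 'cV[R[i]]_(ndof T p)) :
    R[i] :=
  let re z := map_mx (@complex.Re R) z in
  let im z := map_mx (@complex.Im R) z in
  Complex (L2dot (re x) (re y) + L2dot (im x) (im y))
          (L2dot (im x) (re y) - L2dot (re x) (im y)).

Definition L2dotC2 (R : realType) n (T : mesh R n) p
    (x y : 'cV[R[i]]_(ndof T p + ndof T p)) : R[i] :=
  L2dotC (usubmx x) (usubmx y) + L2dotC (dsubmx x) (dsubmx y).

Definition Vinv (R : realType) N (Lam : 'M[R]_N) (tau : R) : 'M[R[i]]_(N + N) :=
  let S := op_pow Lam 2^-1 *m op_pow (1%:M - (tau ^+ 2 / 4) *: Lam) (- 2^-1) in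
  2^-1 *: block_mx ('i *: toC S) 1%:M (- ('i *: toC S)) 1%:M.

(* y^* x is the L2 inner product of x and y. *)
Definition mdot (R : realType) n (T : mesh R n) p (Lam : 'M[R]_(ndof T p))
    (tau alpha : R) (v w : 'cV[R]_(ndof T p + ndof T p)) : R[i] :=
  let G := toC (op_pow Lam (alpha - 1)) in
  L2dotC2 (block_mx G 0 0 G *m (Vinv Lam tau *m toC v)) (Vinv Lam tau *m toC w).

Definition mnorm (R : realType) n (T : mesh R n) p (Lam : 'M[R]_(ndof T p))
    (tau alpha : R) (v : 'cV[R]_(ndof T p + ndof T p)) : R[i] :=
  sqrtC (mdot Lam tau alpha v v).

(* Main.v *)
Require Import Defs.
From HB Require Import structures.
From mathcomp Require Import all_boot all_order all_algebra.
From mathcomp Require Import all_classical all_reals all_analysis.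
From mathcomp Require Import complex.
From mathcomp Require Import measurable_realfun ring lra.

(* Polynomials are integrable on the cells, so L2dot is bilinear, and it is
   positive definite because Lam is: if (u, u) = 0 with u != 0, then
   (t u + w, t u + w) >= 0 for w = Lam u and all t forces (Lam u, u) = 0.  The
   self-adjoint Lam therefore has a real eigenbasis, with eigenvalues l in
   (0, Cs / h^2], so that 1 - tau^2 l / 4 > 0 by the CFL condition.  For real
   v the cross terms of the discrete norm cancel and
     ||v||^2 = 1/2 ((G v2, v2) + (G S v1, S v1)),
   with G = Lam^(alpha - 1) and S^2 (1 - tau^2 Lam / 4) = Lam.  On each
   eigenspace M preserves this form, since
     (1 - tau^2 l / 2)^2 + tau^2 l (1 - tau^2 l / 4) = 1. *)

Set Implicit Arguments.
Unset Strict Implicit.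
Unset Printing Implicit Defensive.

Import Order.TTheory GRing.Theory Num.Theory.
Import numFieldNormedType.Exports.

Local Open Scope classical_set_scope.
Local Open Scope ring_scope.

(** * Abstract inner products on coefficient vectors *)

Definition inner_product (R : realType) m (dot : 'cV[R]_m -> 'cV[R]_m -> R) :=
  [/\ forall a u v w, dot (a *: u + v) w = a * dot u w + dot v w,
      forall u v, dot u v = dot v u &
      forall u, u != 0 -> 0 < dot u u].

Definition self_adjoint (R : realType) m (dot : 'cV[R]_m -> 'cV[R]_m -> R)
    (A : 'M[R]_m) :=
  forall u v, dot (A *m u) v = dot u (A *m v).

Section InnerProduct.
Context (R : realType) (m : nat) (dot : 'cV[R]_m -> 'cV[R]_m -> R).
Hypothesis dotP : inner_product dot.

Lemma ipC u v : dot u v = dot v u. Proof. by case: dotP. Qed.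

Lemma ipDl u v w : dot (u + v) w = dot u w + dot v w.
Proof. by case: dotP => H _ _; have := H 1 u v w; rewrite scale1r mul1r. Qed.

Lemma ip0l w : dot 0 w = 0.
Proof. by apply: (addrI (dot 0 w)); rewrite -ipDl !addr0. Qed.

Lemma ipZl a u w : dot (a *: u) w = a * dot u w.
Proof. by case: dotP => H _ _; have := H a u 0 w; rewrite ip0l !addr0. Qed.

Lemma ipDr u v w : dot w (u + v) = dot w u + dot w v.
Proof. by rewrite ipC ipDl !(ipC w). Qed.

Lemma ipZr a u w : dot w (a *: u) = a * dot w u.
Proof. by rewrite ipC ipZl ipC. Qed.

Lemma ip_ge0 u : 0 <= dot u u.
Proof.
have [->|u0] := eqVneq u 0; first by rewrite ip0l.
by case: dotP => _ _ /(_ u u0)/ltW.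
Qed.

Lemma ip_eq0 u : (dot u u == 0) = (u == 0).
Proof.
have [->|u0] := eqVneq u 0; first by rewrite ip0l eqxx.
by case: dotP => _ _ /(_ u u0) /gt_eqF.
Qed.

Lemma ip_suml (J : finType) (F : J -> 'cV[R]_m) w :
  dot (\sum_j F j) w = \sum_j dot (F j) w.
Proof.
by apply: (big_ind2 (fun u r => dot u w = r)) => [|u _ v _ <- <-|//];
  rewrite ?ip0l ?ipDl.
Qed.

Lemma ip_sumr (J : finType) (F : J -> 'cV[R]_m) w :
  dot w (\sum_j F j) = \sum_j dot w (F j).
Proof. by rewrite ipC ip_suml; apply: eq_bigr => j _; exact: ipC. Qed.

(** The Gram expansion over the columns of [X]. With eigenvectors as columns, the Gram entries
    between distinct eigenvalues vanish. *)
Lemma ip_mulmx k (X : 'M[R]_(m, k)) (a b : 'cV[R]_k) :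
  dot (X *m a) (X *m b) =
  \sum_i \sum_j a i 0 * b j 0 * dot (col i X) (col j X).
Proof.
have mulE (c : 'cV[R]_k) : X *m c = \sum_j c j 0 *: col j X.
  apply/colP => i; rewrite !mxE summxE; apply: eq_bigr => j _.
  by rewrite !mxE mulrC.
rewrite !mulE ip_suml; apply: eq_bigr => i _.
rewrite ip_sumr; apply: eq_bigr => j _.
by rewrite ipZl ipZr mulrA.
Qed.

End InnerProduct.

(** * Spectral theorem for operators self-adjoint for [dot] *)

Lemma char_poly_tr (F : comNzRingType) k (A : 'M[F]_k) :
  char_poly A^T = char_poly A.
Proof.
rewrite /char_poly -[RHS]det_tr; congr (\det _).
by rewrite /char_poly_mx linearB /= tr_scalar_mx map_trmx.
Qed.

Section SelfAdjoint.
Context (R : realType) (m' : nat).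
Let m := m'.+1.
Context (dot : 'cV[R]_m -> 'cV[R]_m -> R).
Hypothesis dotP : inner_product dot.
Implicit Types A B : 'M[R]_m.

(** The exponent descends one step at a time: moving one factor [B] across the inner product gives
    (B^(k+1) v, B^(k+1) v) = (B^(k+2) v, B^k v) = 0. *)
Lemma self_adjoint_nilpotent B k :
  self_adjoint dot B -> B ^+ k.+1 = 0 -> B = 0.
Proof.
move=> sB; elim: k => [|k IH]; first by rewrite expr1.
move=> B0; apply: IH.
suff Bv0 (v : 'cV[R]_m) : B ^+ k.+1 *m v = 0.
  apply/matrixP => i j; have /colP/(_ i) := Bv0 (delta_mx j 0).
  by rewrite -colE !mxE.
apply/eqP; rewrite -(ip_eq0 dotP) {2}exprS -mulmxA -sB mulmxA.
by rewrite -[B *m _]exprS B0 mul0mx (ip0l dotP).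
Qed.

Lemma self_adjoint_horner A (p : {poly R}) :
  self_adjoint dot A -> self_adjoint dot (horner_mx A p).
Proof.
move=> sA; elim/poly_ind: p => [|p c IH] u v.
  by rewrite rmorph0 !mul0mx (ip0l dotP) (ipC dotP) (ip0l dotP).
rewrite rmorphD rmorphM /= horner_mx_X horner_mx_C.
have AB : horner_mx A p * A = A * horner_mx A p.
  by apply: comm_horner_mx.
rewrite {1}AB !mulmxDl (ipDl dotP) (ipDr dotP) -!mulmxA sA IH mulmxA.
by rewrite !mul_scalar_mx (ipZl dotP) (ipZr dotP).
Qed.

(** For a complex eigenvector x + i y, comparing (A x, y) with (x, A y) leaves Im z ((x, x) + (y,
    y)) = 0, and x, y are not both zero. *)
Lemma self_adjoint_root_real A (z : R[i]) :
  self_adjoint dot A -> root (char_poly (toC A)) z -> complex.Im z = 0.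
Proof.
(* [eigenvalue] speaks of row vectors; after transposition, the row eigenvector [w] read as a column
   is an eigenvector of [A]. *)
move=> sA; rewrite -char_poly_tr -eigenvalue_root_char => /eigenvalueP[w wA w0].
pose x := \col_j complex.Re (w 0 j); pose y := \col_j complex.Im (w 0 j).
have Ax : A *m x = complex.Re z *: x - complex.Im z *: y.
  apply/colP => i; have /rowP/(_ i)/(congr1 (@complex.Re R)) := wA.
  rewrite !mxE; case: z {wA} => a b; rewrite raddf_sum /=.
  case: (w 0 i) => c d /=  <-; apply: eq_bigr => j _; rewrite !mxE.
  by case: (w 0 j) => e f /=; rewrite mulr0 subr0 mulrC.
have Ay : A *m y = complex.Im z *: x + complex.Re z *: y.
  apply/colP => i; have /rowP/(_ i)/(congr1 (@complex.Im R)) := wA.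
  rewrite !mxE; case: z {wA Ax} => a b; rewrite raddf_sum /=.
  case: (w 0 i) => c d /=; rewrite addrC => <-; apply: eq_bigr => j _; rewrite !mxE.
  by case: (w 0 j) => e f /=; rewrite mulr0 add0r mulrC.
have := sA x y; rewrite Ax Ay (ipDl dotP) (ipDr dotP) -scaleNr !(ipZl dotP) !(ipZr dotP).
move=> E; have : complex.Im z * (dot x x + dot y y) = 0 by lra.
move/eqP; rewrite mulf_eq0 => /orP[/eqP//|].
rewrite paddr_eq0 ?ip_ge0// !(ip_eq0 dotP) => /andP[/eqP x0 /eqP y0].
case/negP: w0; apply/eqP/rowP => j; rewrite mxE.
have := congr1 (fun u : 'cV_m => u j 0) x0; have := congr1 (fun u : 'cV_m => u j 0) y0.
by rewrite !mxE; case: (w 0 j) => e f /= -> ->.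
Qed.

(** The characteristic polynomial splits over the reals and divides a power of [Q], the product over
    its distinct roots. By Cayley-Hamilton [Q] evaluated at [A] is nilpotent; being self-adjoint it
    is zero, so the minimal polynomial has simple real roots. *)
Lemma self_adjoint_diagonalizable A : self_adjoint dot A -> diagonalizable A.
Proof.
move=> sA.
have [r rE] := closed_field_poly_normal (char_poly (toC A)).
have monC : lead_coef (char_poly (toC A)) = 1 by apply/monicP/char_poly_monic.
rewrite monC scale1r in rE.
pose s := map (@complex.Re R) r.
have cE : char_poly A = \prod_(a <- s) ('X - a%:P).
  apply: (map_poly_inj (real_complex R)).
  rewrite map_char_poly rE rmorph_prod /= big_map.
  apply: eq_big_seq => z zr; rewrite map_polyXsubC; congr (_ - _%:P).
  have : root (char_poly (toC A)) z by rewrite rE root_prod_XsubC.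
  by move=> /(self_adjoint_root_real sA); case: z {zr} => a b /= ->.
pose Q := \prod_(a <- undup s) ('X - a%:P).
have cQ : char_poly A %| Q ^+ (size s).+1.
  rewrite cE.
  have : {subset s <= s} by [].
  (* Induction on a list [t] of roots taken from [s], with [Q] fixed: each linear factor divides one
     copy of [Q]. *)
  elim: {-2}s => [_|a t IH ts]; first by rewrite big_nil dvd1p.
  rewrite big_cons exprS dvdp_mul//; last by apply: IH => b bt; apply: ts; rewrite inE bt orbT.
  by rewrite dvdp_XsubCl root_prod_XsubC mem_undup ts ?mem_head.
apply/diagonalizableP; exists (undup s); first exact: undup_uniq.
apply: mxminpoly_min; apply: (@self_adjoint_nilpotent _ (size s)).
  exact: self_adjoint_horner.
rewrite -rmorphXn /=.
have /dvdpP[q ->] := cQ.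
by rewrite rmorphM /= Cayley_Hamilton mulr0.
Qed.

End SelfAdjoint.

Lemma self_adjoint_eigenbasis (R : realType) m
    (dot : 'cV[R]_m -> 'cV[R]_m -> R) (A : 'M[R]_m) :
  inner_product dot -> self_adjoint dot A ->
  exists (X : 'M[R]_m) (d : 'rV[R]_m), X \in unitmx /\ A *m X = X *m diag_mx d.
Proof.
case: m dot A => [|m] dot A dotP sA.
  by exists 1%:M, 0; split; [exact: unitmx1 | rewrite !flatmx0].
have [P Pu /diagonalizable_forPex[d /(simmxP Pu) PA]] :=
  self_adjoint_diagonalizable dotP sA.
(* The rows of [P] are left eigenvectors; the columns of its inverse are the right ones. *)
exists (invmx P), d; rewrite unitmx_inv; split => //.
by apply: (can_inj (mulKmx Pu)); rewrite mulKVmx// mulmxA PA mulmxK.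
Qed.

(** * Real powers of a diagonalized operator *)

Lemma col_mul_diag (R : realType) m (X : 'M[R]_m) (e : 'rV[R]_m) j :
  col j (X *m diag_mx e) = e 0 j *: col j X.
Proof. by rewrite mul_mx_diag; apply/colP => i; rewrite !mxE mulrC. Qed.

(** [op_pow] is a choice, so some operator with its defining property must be exhibited: X D X^-1.
    It acts correctly on every eigenvector, since each eigenbasis coordinate of an eigenvector for
    [l] either is zero or belongs to an entry of [d] equal to [l]. *)
Lemma op_pow_diag (R : realType) m (A X : 'M[R]_m) (d : 'rV[R]_m) (s : R) :
  X \in unitmx -> A *m X = X *m diag_mx d ->
  op_pow A s *m X = X *m diag_mx (map_mx (fun l => l `^ s) d).
Proof.
move=> Xu AX; set D := diag_mx (map_mx _ d).
have opE (l : R) (v : 'cV[R]_m) : A *m v = l *: v -> op_pow A s *m v = l `^ s *: v.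
  move: l v.
  pose P B := forall l (v : 'cV[R]_m), A *m v = l *: v -> B *m v = l `^ s *: v.
  suff /(xgetPex 0) : exists B, P B by [].
  exists (X *m D *m invmx X) => l v Av.
  pose w := invmx X *m v; have vE : v = X *m w by rewrite mulmxA mulmxV// mul1mx.
  have dw : diag_mx d *m w = l *: w.
    apply: (can_inj (mulKmx Xu)).
    by rewrite mulmxA -AX -mulmxA -vE Av -scalemxAr -vE.
  suff Dw : D *m w = l `^ s *: w.
    by rewrite -!mulmxA -/w Dw -scalemxAr -vE.
  apply/colP => j; have /colP/(_ j) := dw.
  rewrite !mul_diag_mx !mxE => /eqP.
  by rewrite -subr_eq0 -mulrBl mulf_eq0 subr_eq0 => /orP[/eqP->//|/eqP->]; rewrite !mulr0.
apply/matrixP => i j.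
have : col j (op_pow A s *m X) = col j (X *m D).
  rewrite col_mul_diag mxE colE -mulmxA -colE; apply: opE.
  by rewrite colE mulmxA -colE AX col_mul_diag colE.
by move=> /colP/(_ i); rewrite !mxE.
Qed.

(** * Bounded functions on bounded sets in the product model of Lebesgue measure *)

Section LebesgueModel.
Context (R : realType).

Lemma measurable_model_pt m (j : 'I_m) :
  measurable_fun setT (fun y => @model_pt R m y j 0).
Proof.
elim: m j => [[]//|m IH j].
rewrite [X in measurable_fun _ X](_ : _ = fun y : mm_car (lebesgue_model R m) * R =>
    match fintype.split (j : 'I_(1 + m)) with
    | inl _ => y.2 | inr k => model_pt y.1 k 0 end); last first.
  by apply/funext => y; rewrite /model_pt /= mxE; case: fintype.split => k;
    rewrite // !mxE !ord1.
case: fintype.split => k; first exact: measurable_snd.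
apply: (measurableT_comp (IH k)); exact: measurable_fst.
Qed.

(** The closed sup-norm ball: in the product model its preimage is a product of intervals, so its
    measure is finite by induction on the dimension. *)
Definition cube m (c : R) : set 'cV[R]_m := [set x | forall j, `|x j 0| <= c].

Lemma cube_preimage m c :
  @model_pt R m @^-1` @cube m c =
  \bigcap_(j in setT) [set y | `|model_pt y j 0| <= c].
Proof. by apply/seteqP; split => y /= H j => [_|]; exact: H. Qed.

Lemma measurable_cube m c : measurable (@model_pt R m @^-1` @cube m c).
Proof.
rewrite cube_preimage; apply: fin_bigcap_measurable => [|j _]; first exact: finite_finset.
rewrite [X in measurable X](_ : _ =
    setT `&` (fun y => model_pt y j 0) @^-1` [set` `[- c, c]]).
  exact: measurable_model_pt.
by rewrite setTI; apply/seteqP; split => y /=; rewrite in_itv /= ler_norml.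
Qed.

Lemma finite_cube m c :
  (mm_leb (lebesgue_model R m) (@model_pt R m @^-1` @cube m c) < +oo)%E.
Proof.
elim: m => [|m IH].
  by rewrite /= diracE; case: (_ \in _); rewrite ltry.
rewrite [X in mm_leb _ X](_ : _ =
    (@model_pt R m @^-1` @cube m c) `*` [set` `[- c, c]]); last first.
  apply/seteqP; split => -[y t] /=; rewrite /cube /model_pt /=.
    move=> H; split => [j|].
      by have := H (rshift 1 j); rewrite (@col_mxEd _ 1%N).
    have := H (lshift m (ord0 : 'I_1)).
    by rewrite (@col_mxEu _ 1%N) mxE eqxx mulr1n in_itv /= ler_norml.
  move=> [H1 H2] j; rewrite -(splitK (j : 'I_(1 + m))).
  case: fintype.split => k; rewrite ?(@col_mxEu _ 1%N) ?(@col_mxEd _ 1%N) //=.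
  by rewrite mxE !ord1 eqxx mulr1n ler_norml; move: H2; rewrite in_itv.
have -> : mm_leb (lebesgue_model R m.+1)
    ((@model_pt R m @^-1` @cube m c) `*` [set` `[- c, c]]) =
    (mm_leb (lebesgue_model R m) (@model_pt R m @^-1` @cube m c) *
     lebesgue_measure ([set` `[(- c)%R, c%R]] : set R))%E.
  by apply: product_measure1E => //; exact: measurable_cube.
rewrite lebesgue_measure_itv /=.
(* [c] may be nonpositive; the length of the interval is then 0. *)
case: ifP => [cc|_]; last by rewrite mule0 ltry.
rewrite -EFinB muleC lte_mul_pinfty// lee_fin subr_ge0.
by rewrite lte_fin in cc; exact: ltW.
Qed.

Lemma bounded_integrable_model m (A : set 'cV[R]_m) (f : 'cV[R]_m -> R) (c b : R) :
  measurable (@model_pt R m @^-1` A) -> A `<=` @cube m c ->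
  measurable_fun setT (f \o @model_pt R m) -> (forall x, A x -> `|f x| <= b) ->
  (mm_leb (lebesgue_model R m)).-integrable (@model_pt R m @^-1` A)
    (EFin \o (fun y => f (model_pt y))).
Proof.
move=> mA Ac mf fb; apply: measurable_bounded_integrable => //.
- apply: le_lt_trans (finite_cube m c); apply: le_measure; rewrite ?inE//.
    exact: measurable_cube.
  by move=> y; exact: Ac.
- exact: measurable_funTS.
exists b; split; first exact: num_real.
by move=> M bM y /= Ay; apply: le_trans (fb _ Ay) (ltW bM).
Qed.

End LebesgueModel.

(** * Measurability and boundedness of mesh cells *)

Section Cells.
Context (R : realType) (n : nat).
Implicit Types K : Defs.patch R n.+1 n.+1.

(** A cell is defined as an image; as a preimage under the inverse chart it inherits measurability
    from the reference cell. *)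
Lemma carrier_preimage K : edg K \in unitmx ->
  carrier K = [set x | ref_cell (shp K) (invmx (edg K) *m (x - org K))].
Proof.
move=> Ku; apply/seteqP; split => [_ [y Ky <-]|x Kx] /=.
  by rewrite /chart addrC addKr mulKmx.
by exists (invmx (edg K) *m (x - org K)) => //; rewrite /chart mulKVmx// addrC subrK.
Qed.

Lemma measurable_carrier K : edg K \in unitmx ->
  measurable (@model_pt R n.+1 @^-1` carrier K).
Proof.
move=> /carrier_preimage ->.
(* [g i] is the i-th reference coordinate of a point. Both shapes are cut out by interval conditions
   on the [g i], together with one on their sum for a simplex. *)
pose g (i : 'I_n.+1) y := (invmx (edg K) *m (@model_pt R n.+1 y - org K)) i 0.
have mg i : measurable_fun setT (g i).
  rewrite [g i](_ : _ = fun y => \sum_j invmx (edg K) i j * (model_pt y j 0 - org K j 0)).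
    apply: measurable_sum => j; apply: measurable_funM => //.
    by apply: measurable_funB => //; exact: measurable_model_pt.
  by apply/funext => y; rewrite /g mxE; apply: eq_bigr => j _; rewrite !mxE.
have mI i (J : interval R) : measurable [set y | g i y \in J].
  by rewrite -[X in measurable X]setTI;
     exact: (mg i measurableT [set` J] (measurable_itv J)).
case: shp => /=.
  rewrite [X in measurable X](_ : _ = (\bigcap_(i in setT) [set y | g i y \in `[0, +oo[])
     `&` [set y | \sum_i g i y \in `]-oo, 1]]).
    apply: measurableI.
      by apply: fin_bigcap_measurable => [|i _]; [exact: finite_finset | exact: mI].
    rewrite -[X in measurable X]setTI.
    have mS : measurable_fun setT (fun y => \sum_i g i y) by apply: measurable_sum.
    exact: (mS measurableT _ (measurable_itv `]-oo, 1])).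
  apply/seteqP; split => y /=; rewrite in_itv /= => -[H1 H2]; split => // i.
    by move=> _ /=; rewrite in_itv /= H1.
  by have := H1 i I; rewrite /= in_itv /= andbT.
rewrite [X in measurable X](_ : _ = (\bigcap_(i in setT) [set y | g i y \in `[0, 1]])).
  by apply: fin_bigcap_measurable => [|i _]; [exact: finite_finset | exact: mI].
apply/seteqP; split => y /= H i.
  by move=> _ /=; rewrite in_itv /= H.
by have := H i I; rewrite /= in_itv.
Qed.

Lemma carrier_bounded K : exists c, carrier K `<=` @cube R n.+1 c.
Proof.
(* Reference coordinates are at most 1 in modulus, so the j-th summand bounds the j-th coordinate on
   the cell; summing over [j] gives one bound for all. *)
exists (\sum_j (`|org K j 0| + \sum_k `|edg K j k|)) => _ [y Ky <-] j.
have y1 k : `|y k 0| <= 1.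
  move: Ky; case: shp => /= [[y0 ys]|/(_ k)/andP[y0 y1]]; last by rewrite ger0_norm.
  rewrite ger0_norm//; apply: le_trans ys; rewrite (bigD1 k)//= lerDl sumr_ge0//.
rewrite (bigD1 j)//= -[X in X <= _]addr0 lerD//; last first.
  by apply: sumr_ge0 => k _; rewrite addr_ge0// sumr_ge0.
rewrite /chart !mxE (le_trans (ler_normD _ _))// lerD2l.
rewrite (le_trans (ler_norm_sum _ _ _))//; apply: ler_sum => k _.
by rewrite normrM ler_piMr.
Qed.

End Cells.

(** * Bilinearity of the L2 product of piecewise polynomials *)

Section L2dot.
Context (R : realType) (n : nat) (T : mesh R n) (p : nat).
Hypothesis unit_edg : forall K, edg (cell (m := T) K) \in unitmx.
Implicit Types (u v w : 'cV[R]_(ndof T p)) (K : 'I_(ncells T)).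

Lemma on_cell_linear a u v K x :
  on_cell (a *: u + v) K x = a * on_cell u K x + on_cell v K x.
Proof.
rewrite /on_cell mulr_sumr -big_split /=; apply: eq_bigr => b _.
by rewrite !mxE mulrDl mulrA.
Qed.

Lemma measurable_on_cell u K :
  measurable_fun setT (fun y => on_cell u K (@model_pt R n.+1 y)).
Proof.
apply: measurable_sum => a; apply: measurable_funM => //.
by apply: measurable_prod => j _; apply: measurable_funX; exact: measurable_model_pt.
Qed.

Lemma on_cell_bounded u K :
  exists b, forall x, carrier (cell K) x -> `|on_cell u K x| <= b.
Proof.
have [c Kc] := carrier_bounded (cell K).
exists (\sum_(a : multi_index n p)
  `|u (enum_rank (K, a)) 0| * \prod_j c ^+ (val a j)) => x /Kc xc.
rewrite (le_trans (ler_norm_sum _ _ _))//; apply: ler_sum => a _.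
rewrite normrM ler_wpM2l// normr_prod ler_prod// => j _.
rewrite normr_ge0 normrX /= lerXn2r ?nnegrE//; exact: le_trans (xc j).
Qed.

Lemma integrable_on_cellM u v K :
  (mm_leb (lebesgue_model R n.+1)).-integrable (@model_pt R n.+1 @^-1` carrier (cell K))
    (EFin \o (fun y => on_cell u K (model_pt y) * on_cell v K (model_pt y))).
Proof.
have [c Kc] := carrier_bounded (cell K).
have [bu ub] := on_cell_bounded u K; have [bv vb] := on_cell_bounded v K.
apply: (@bounded_integrable_model _ _ _
  (fun x => on_cell u K x * on_cell v K x) c (bu * bv)) => //.
- exact: measurable_carrier.
- by apply: measurable_funM; exact: measurable_on_cell.
by move=> x Kx; rewrite normrM ler_pM//; [exact: ub | exact: vb].
Qed.

(** Additivity of the integral rests on integrability of both terms, which holds because polynomials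
    are bounded on cells of finite measure. *)
Lemma L2dot_linear a u v w : L2dot (a *: u + v) w = a * L2dot u w + L2dot v w.
Proof.
rewrite /L2dot mulr_sumr -big_split /=; apply: eq_bigr => K _.
have mK := measurable_carrier (unit_edg K).
rewrite /cell_int /leb_int -RintegralZl//; last exact: integrable_on_cellM.
rewrite -RintegralD//; last 2 first.
- exact: integrableZl (integrable_on_cellM u w K).
- exact: integrable_on_cellM.
by congr Rintegral; apply/funext => y; rewrite on_cell_linear mulrDl mulrA.
Qed.

Lemma L2dot_sym u v : L2dot u v = L2dot v u.
Proof.
apply: eq_bigr => K _; congr leb_int; apply/funext => x; exact: mulrC.
Qed.

Lemma L2dot_ge0 u : 0 <= L2dot u u.
Proof.
by apply: sumr_ge0 => K _; apply: Rintegral_ge0 => y _; rewrite -expr2 sqr_ge0.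
Qed.

End L2dot.

(** * Energy conservation of the scheme, mode by mode *)

Lemma eigenvectors_orthogonal (R : realType) m
    (dot : 'cV[R]_m -> 'cV[R]_m -> R) (A X : 'M[R]_m) (d : 'rV[R]_m) j k :
  inner_product dot -> self_adjoint dot A -> A *m X = X *m diag_mx d ->
  d 0 j != d 0 k -> dot (col j X) (col k X) = 0.
Proof.
move=> dotP sA AX; rewrite -subr_eq0 => djk; apply: (mulfI djk).
have Acol i : A *m col i X = d 0 i *: col i X by rewrite colE mulmxA -colE AX col_mul_diag colE.
by rewrite mulr0 mulrBl -(ipZl dotP) -(ipZr dotP) -!Acol sA subrr.
Qed.

(* In an eigenbasis the scheme acts mode by mode: for the eigenvalue l, the
   quadratic form s(l)^2 w1^2 + w2^2 is invariant as soon as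
   s(l)^2 (1 - tau^2 l / 4) = l. *)
Lemma leapfrog_energy (R : realType) m (dot : 'cV[R]_m -> 'cV[R]_m -> R)
    (A G S X : 'M[R]_m) (d : 'rV[R]_m) (g s : R -> R) (tau : R)
    (v1 v2 : 'cV[R]_m) :
  inner_product dot -> self_adjoint dot A ->
  X \in unitmx -> A *m X = X *m diag_mx d ->
  G *m X = X *m diag_mx (map_mx g d) -> S *m X = X *m diag_mx (map_mx s d) ->
  (forall j, s (d 0 j) ^+ 2 * (1 - tau ^+ 2 / 4 * d 0 j) = d 0 j) ->
  let E (u1 u2 : 'cV[R]_m) :=
    dot (G *m u2) u2 + dot (G *m (S *m u1)) (S *m u1) in
  E ((1%:M - (tau ^+ 2 / 2) *: A) *m v1 + (tau *: 1%:M - (tau ^+ 3 / 4) *: A) *m v2)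
    (- (tau *: A) *m v1 + (1%:M - (tau ^+ 2 / 2) *: A) *m v2) = E v1 v2.
Proof.
move=> dotP sA Xu AX GX SX sE /=.
have vE (v : 'cV[R]_m) : v = X *m (invmx X *m v) by rewrite mulKVmx.
rewrite (vE v1) (vE v2); move: (invmx X *m v1) (invmx X *m v2) => w1 w2.
pose D := diag_mx d.
have -> : (1%:M - (tau ^+ 2 / 2) *: A) *m (X *m w1)
    + (tau *: 1%:M - (tau ^+ 3 / 4) *: A) *m (X *m w2)
  = X *m ((1%:M - (tau ^+ 2 / 2) *: D) *m w1
          + (tau *: 1%:M - (tau ^+ 3 / 4) *: D) *m w2).
  rewrite mulmxDr !mulmxA !(mulmxBl, mulmxBr, =^~ scalemxAl, =^~ scalemxAr).
  by rewrite !mul1mx !mulmx1 AX.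
have -> : - (tau *: A) *m (X *m w1) + (1%:M - (tau ^+ 2 / 2) *: A) *m (X *m w2)
  = X *m (- (tau *: D) *m w1 + (1%:M - (tau ^+ 2 / 2) *: D) *m w2).
  rewrite mulmxDr !mulmxA !(mulmxBl, mulmxBr, mulNmx, mulmxN, =^~ scalemxAl, =^~ scalemxAr).
  by rewrite !mul1mx !mulmx1 AX.
rewrite !(mulmxA S) SX -!(mulmxA X) !(mulmxA G) GX -!(mulmxA X).
rewrite !(ip_mulmx dotP) -!big_split /=; apply: eq_bigr => j _.
rewrite -!big_split /=; apply: eq_bigr => k _.
(* Pairs with distinct eigenvalues contribute nothing. Eigenvectors sharing an eigenvalue need not
   be orthogonal, so for these the polarized identity is proved, with separate coordinates for [j]
   and [k]. *)
have [djk|/(eigenvectors_orthogonal dotP sA AX) ->] := eqVneq (d 0 j) (d 0 k);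
  last by rewrite !mulr0.
rewrite -!mulrDl; congr (_ * _).
rewrite !(mulmxBl, mulNmx) -!scalemxAl !mul1mx !mul_diag_mx !mxE -djk.
have := sE j; move: (d 0 j) => l sl.
set a := w1 j 0; set b := w2 j 0; set a' := w1 k 0; set b' := w2 k 0.
apply/eqP; rewrite -subr_eq0; apply/eqP.
(* The change of energy is a multiple of s(l)^2 (1 - tau^2 l / 4) - l, which vanishes by [sE]. *)
transitivity (g l * (s l ^+ 2 * (1 - tau ^+ 2 / 4 * l) - l) *
  (tau ^+ 2 * (1 - tau ^+ 2 / 4 * l) * (b * b')
   + tau * (1 - tau ^+ 2 / 2 * l) * (a * b' + a' * b)
   - tau ^+ 2 * l * (a * a'))).
  by field.
by rewrite sl subrr mulr0 mul0r.
Qed.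

(** * The discrete norm of real vectors *)

Section Complexification.
Context (R : realType) (n : nat) (T : mesh R n) (p : nat).
Implicit Types x y : 'cV[R]_(ndof T p).

Lemma L2dotC_parts x y x' y' :
  L2dotC (toC x + 'i *: toC y) (toC x' + 'i *: toC y') =
  Complex (L2dot x x' + L2dot y y') (L2dot y x' - L2dot x y').
Proof.
have reE m (u v : 'cV[R]_m) : map_mx (@complex.Re R) (toC u + 'i *: toC v) = u.
  by apply/colP => j; rewrite !mxE -complexiE /= !(mul0r, mul1r) subrr addr0.
have imE m (u v : 'cV[R]_m) : map_mx (@complex.Im R) (toC u + 'i *: toC v) = v.
  by apply/colP => j; rewrite !mxE -complexiE /= !(mul0r, mul1r, add0r).
by rewrite /L2dotC !reE !imE.
Qed.

Lemma toC_mulmx_parts m k (A : 'M[R]_(m, k)) (x y : 'cV[R]_k) :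
  toC A *m (toC x + 'i *: toC y) = toC (A *m x) + 'i *: toC (A *m y).
Proof. by rewrite mulmxDr -scalemxAr /toC !map_mxM. Qed.

Lemma mdot_diag (Lam : 'M[R]_(ndof T p)) (tau alpha : R)
    (v1 v2 : 'cV[R]_(ndof T p)) :
  (forall K, edg (cell (m := T) K) \in unitmx) ->
  let S := op_pow Lam 2^-1 *m op_pow (1%:M - (tau ^+ 2 / 4) *: Lam) (- 2^-1) in
  let G := op_pow Lam (alpha - 1) in
  mdot Lam tau alpha (col_mx v1 v2) (col_mx v1 v2) =
  (2^-1 * (L2dot (G *m v2) v2 + L2dot (G *m (S *m v1)) (S *m v1)))%:C%C.
Proof.
move=> Tu S G; rewrite /mdot /Vinv -/S -/G /toC.
have -> : map_mx (real_complex R) (col_mx v1 v2) = col_mx (toC v1) (toC v2).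
  by rewrite map_col_mx.
(* The two components of V^-1 v are the conjugates x + i y and x - i y. Their contributions have
   opposite imaginary parts and equal real parts, whence the final factor 1/2. *)
pose x := 2^-1 *: v2; pose y := 2^-1 *: (S *m v1).
have toCZ (u : 'cV[R]_(ndof T p)) : toC (2^-1 *: u) = 2^-1 *: toC u.
  by rewrite /toC map_mxZ /= fmorphV rmorph_nat.
rewrite -scalemxAl mul_block_col !mul1mx scale_col_mx mul_block_col !mul0mx addr0 add0r.
have -> : 2^-1 *: ('i *: toC S *m toC v1 + toC v2) = toC x + 'i *: toC y.
  rewrite addrC !toCZ scalerDr -scalemxAl /toC (map_mxM _ S v1); congr (_ + _).
  by rewrite !scalerA mulrC.
have -> : 2^-1 *: (- ('i *: toC S) *m toC v1 + toC v2) = toC x + 'i *: toC (- y).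
  rewrite addrC /y -(scalerN _ (S *m v1)) !toCZ scalerDr mulNmx -scalemxAl.
  rewrite /toC map_mxN (map_mxM _ S v1).
  by rewrite !scalerN !scalerA mulrC.
rewrite !toC_mulmx_parts /L2dotC2 !col_mxKu !col_mxKd !L2dotC_parts.
have linP := L2dot_linear (p := p) Tu.
have Z a u w : L2dot (a *: u) w = a * L2dot (T := T) (p := p) u w.
  have L0 : L2dot 0 w = 0 by have := linP (-1) w w w; rewrite scaleN1r addNr mulN1r addNr.
  by have := linP a u 0 w; rewrite L0 !addr0.
have C := @L2dot_sym R n T p.
have Zr a u w : L2dot w (a *: u) = a * L2dot (T := T) (p := p) w u by rewrite C Z C.
rewrite -(scaleN1r y) -!scalemxAr !Z !Zr.
apply/eqP; rewrite eq_complex /=; apply/andP; by split; apply/eqP; field.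
Qed.

End Complexification.

(** * Positive definiteness of the L2 product, the CFL bound and conservation of the norm *)

Lemma L2dot_inner_product (R : realType) n (T : mesh R n) p
    (A : 'M[R]_(ndof T p)) :
  (forall K, edg (cell (m := T) K) \in unitmx) ->
  (forall u : 'cV_(ndof T p), u != 0 -> 0 < L2dot (A *m u) u) ->
  inner_product (@L2dot R n T p).
Proof.
move=> Tu posA; have linP := L2dot_linear (p := p) Tu; have C := @L2dot_sym R n T p.
split => // u u0; rewrite lt_neqAle L2dot_ge0 andbT; apply/negP => /eqP uu.
have := posA u u0; set w := A *m u => q_gt0.
(* When (u, u) = 0 the square of t u + w is 2 t (w, u) + (w, w); this [t] makes it equal to -1. *)
pose t := - (L2dot w w + 1) / (2 * L2dot w u).
have := L2dot_ge0 (t *: u + w).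
rewrite linP [X in t * X]C linP [X in _ + X]C linP -uu (C u w).
suff -> : t * (t * 0 + L2dot w u) + (t * L2dot w u + L2dot w w) = -1 by rewrite oppr_ge0 ler10.
rewrite /t; field; exact: lt0r_neq0.
Qed.

(** The CFL condition gives tau sqrt(Cs) < 2 h; squaring yields tau^2 Cs < 4 h^2, that is, tau^2 / 4
    times the largest admissible [l] is below 1. *)
Lemma cfl_bound (R : realType) (Cs C h tau l : R) :
  0 < Cs -> C < 2 / Num.sqrt Cs -> 0 <= h -> 0 < tau -> tau < C * h ->
  l <= Cs * h ^- 2 -> 0 < 1 - tau ^+ 2 / 4 * l.
Proof.
move=> Cs0 CC h0 t0 tC lC.
(* The value h = 0 would force tau < 0. *)
have h_gt0 : 0 < h.
  by rewrite lt_neqAle h0 andbT; apply: contraTneq (lt_trans t0 tC) => <-; rewrite mulr0 ltxx.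
have sC : 0 < Num.sqrt Cs by rewrite sqrtr_gt0.
have lt2h : tau * Num.sqrt Cs < 2 * h.
  rewrite ltr_pdivlMr// in CC; apply: lt_trans (_ : C * h * Num.sqrt Cs < _).
    by rewrite ltr_pM2r.
  by rewrite mulrAC ltr_pM2r.
have sq : tau ^+ 2 * Cs < 4 * h ^+ 2.
  rewrite -[X in _ * X](sqr_sqrtr (ltW Cs0)) -exprMn.
  rewrite (_ : 4 * h ^+ 2 = (2 * h) ^+ 2); last by ring.
  by rewrite ltrXn2r ?nnegrE// ?mulr_ge0// ltW.
rewrite subr_gt0; apply: le_lt_trans (_ : tau ^+ 2 / 4 * (Cs * h ^- 2) < _).
  by rewrite ler_wpM2l// divr_ge0// sqr_ge0.
rewrite (_ : _ * _ = tau ^+ 2 * Cs / (4 * h ^+ 2)); last by field; exact: lt0r_neq0.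
by rewrite ltr_pdivrMr ?mul1r// mulr_gt0// exprn_gt0.
Qed.

Theorem lemma4p2
  (R : realType) (n : nat) (d_le3 : (n.+1 <= 3)%N)
  (Dom : set 'cV[R]_n.+1) (Dom_poly : convex_polytopal Dom)
  (dmin dmax : R) (D : 'cV[R]_n.+1 -> 'M[R]_n.+1)
  (D_tensor : diffusion_tensor Dom dmin dmax D)
  (I : Type) (T : I -> mesh R n)
  (T_mesh : forall i, mesh_of Dom (T i))
  (T_reg : regular_quasi_uniform T)
  (p : nat) (p_ge1 : (1 <= p)%N)
  (sigma0 : R) (sigma0_gt0 : 0 < sigma0)
  (coercive : forall i (u : 'cV[R]_(ndof (T i) p)),
     2^-1 * star_norm_sq Dom u <= Bh Dom D sigma0 u u)
  (Cs : R) (Cs_gt0 : 0 < Cs)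
  (inverse_bound : forall i (u : 'cV[R]_(ndof (T i) p)),
     Bh Dom D sigma0 u u <= Cs * hmax (T i) ^- 2 * L2dot u u)
  (C_CFL : R) (C_CFL_lt : C_CFL < 2 / Num.sqrt Cs)
  (i : I) (Lam : 'M[R]_(ndof (T i) p))
  (Lam_def : is_Lambda Dom D sigma0 Lam)
  (tau : R) (tau_gt0 : 0 < tau) (CFL : tau < C_CFL * hmax (T i)) :
  let M : 'M[R]_(ndof (T i) p + ndof (T i) p) :=
    block_mx
      (1%:M - (tau ^+ 2 / 2) *: Lam) (tau *: 1%:M - (tau ^+ 3 / 4) *: Lam)
      (- (tau *: Lam))               (1%:M - (tau ^+ 2 / 2) *: Lam) in
  forall (alpha : R) (v1 v2 : 'cV[R]_(ndof (T i) p)),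
    mnorm Lam tau alpha (M *m col_mx v1 v2) = mnorm Lam tau alpha (col_mx v1 v2).
Proof.
move=> M alpha v1 v2.
have [Tu _ _ _] := T_mesh i; have [LamE sA posA] := Lam_def.
have dotP := L2dot_inner_product Tu posA.
have [X [d [Xu AX]]] := self_adjoint_eigenbasis dotP sA.
have colX0 j : col j X != 0.
  apply/negP => /eqP X0; have : delta_mx j 0 != 0 :> 'cV[R]_(ndof (T i) p).
    by apply/eqP => /colP/(_ j); rewrite !mxE !eqxx => /eqP; rewrite oner_eq0.
  by rewrite -(mulKmx Xu (delta_mx j 0)) -colE X0 mulmx0 eqxx.
have Acol j : Lam *m col j X = d 0 j *: col j X.
  by rewrite colE mulmxA -colE AX col_mul_diag colE.
have xx_gt0 j : 0 < L2dot (col j X) (col j X) by case: dotP => _ _; exact.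
have d_gt0 j : 0 < d 0 j.
  by have := posA _ (colX0 j); rewrite Acol (ipZl dotP) pmulr_lgt0.
(* The inverse bound tested on an eigenvector, where the form [Bh] is the eigenvalue times the
   squared norm. *)
have d_le j : d 0 j <= Cs * hmax (T i) ^- 2.
  have := inverse_bound i (col j X).
  by rewrite -LamE Acol (ipZl dotP) ler_pM2r.
pose r l := 1 - tau ^+ 2 / 4 * l.
have r_gt0 j : 0 < r (d 0 j).
  apply: (cfl_bound Cs_gt0 C_CFL_lt _ tau_gt0 CFL (d_le j)).
  (* [hmax] is nonnegative because its maximum starts from 0. *)
  exact: bigmax_ge_id.
(* [X] diagonalizes I - tau^2 Lam / 4 as well, with eigenvalues r(l), so [op_pow_diag] applies to
   both factors of [S]. *)
have PX : (1%:M - (tau ^+ 2 / 4) *: Lam) *m X = X *m diag_mx (map_mx r d).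
  rewrite mulmxBl mul1mx -scalemxAl AX; apply/matrixP => a b.
  by rewrite !mul_mx_diag !mxE /r; ring.
pose s l := l `^ 2^-1 * (r l) `^ (- 2^-1).
pose S := op_pow Lam 2^-1 *m op_pow (1%:M - (tau ^+ 2 / 4) *: Lam) (- 2^-1).
have SX : S *m X = X *m diag_mx (map_mx s d).
  rewrite -mulmxA (op_pow_diag _ Xu PX) mulmxA (op_pow_diag _ Xu AX).
  by apply/matrixP => a b; rewrite !mul_mx_diag !mxE mulrA.
(* Since [l] and [r l] are positive, the half powers are genuine square roots and s(l)^2 = l /
   r(l). *)
have sE j : s (d 0 j) ^+ 2 * (1 - tau ^+ 2 / 4 * d 0 j) = d 0 j.
  rewrite /s -/(r _) powRN !powR12_sqrt ?ltW// exprMn exprVn !sqr_sqrtr ?ltW//.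
  by rewrite divfK// lt0r_neq0.
rewrite /mnorm /M mul_block_col !mdot_diag//; congr (sqrtC (_ * _)%:C%C).
exact: (leapfrog_energy v1 v2 dotP sA Xu AX (op_pow_diag _ Xu AX) SX sE).
Qed.
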